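(* For every integer $n\ge 13$, $\gamma^{\mathrm{ID}}(\mathrm{C}_n(1,3))\ge 4n/11$.
   Context: For an integer $n\ge 7$, the circulant graph $\mathrm{C}_n(1,3)$ has vertex set $\mathbb{Z}_n$, with $x,y$ adjacent iff $x-y\equiv \pm1$ or $\pm3 \pmod n$. For a graph $G=(V,E)$ and $u\in V$, $N[u]$ is the closed neighbourhood of $u$, and for $S\subseteq V$, $S_u=N[u]\cap S$. A set $S\subseteq V$ is an identifying code if the sets $S_u$, $u\in V$, are all nonempty and pairwise distinct. $\gamma^{\mathrm{ID}}(G)$ is the minimum size of an identifying code of $G$. *)

(* Defs.v *)
From mathcomp Require Import all_boot all_order all_algebra ring.

Set Implicit Arguments.
Unset Strict Implicit.
Unset Printing Implicit Defensive.

Import GRing.Theory.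

Section IdentifyingCodes.

(* A graph is given by its adjacency relation e on the vertex type T. *)
Variables (T : finType) (e : rel T).

Definition closed_nbh (u : T) : {set T} := [set v | (v == u) || e u v].

Definition code_trace (S : {set T}) (u : T) : {set T} := closed_nbh u :&: S.

Definition identifying_code (S : {set T}) : bool :=
  [forall u, code_trace S u != set0] && injectiveb (code_trace S).

(* Minimum size of an identifying code. When the graph has no identifying code
   the value is the junk value #|T|; circ13_identifiable below shows that this
   does not happen for the graphs circ13 n with 7 <= n. *)
Definition gammaID : nat := #|[arg min_(S < setT | identifying_code S) #|S| ]|.

Lemma identifying_codeP (S : {set T}) :
  reflect ((forall u, code_trace S u != set0) /\
           (forall u v, u != v -> code_trace S u != code_trace S v))
          (identifying_code S).
Proof.
apply: (iffP andP) => -[].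
  move=> /forallP h0 /injectiveP h1; split=> // u v.
  by apply: contraNneq => /h1 ->.
move=> h0 h1; split; first exact/forallP.
apply/injectiveP => u v E; apply/eqP/negPn/negP => /h1.
by rewrite E eqxx.
Qed.

Lemma gammaIDP : (exists S, identifying_code S) ->
  (exists2 S, identifying_code S & #|S| = gammaID) /\
  (forall S, identifying_code S -> gammaID <= #|S|).
Proof.
case=> S0 hS0.
have hT : identifying_code setT.
  have [h0 /injectiveP h1] := andP hS0.
  have E u : code_trace S0 u = code_trace setT u :&: S0.
    by rewrite /code_trace setIT.
  apply/andP; split.
    apply/forallP => u; have := forallP h0 u.
    by rewrite E; apply: contraNneq => ->; rewrite set0I.
  by apply/injectiveP => u v huv; apply: h1; rewrite !E huv.
rewrite /gammaID; case: arg_minnP => //= S hS hmin.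
by split=> //; exists S.
Qed.

End IdentifyingCodes.

Local Open Scope ring_scope.

(* The circulant graph C_n(1,3). For n <= 1 the type 'Z_n is Z/2. *)
Definition circ13 (n : nat) : rel 'Z_n :=
  fun x y => x - y \in [:: 1; -1; 3; -3].
Arguments circ13 : clear implicits.

Lemma circ13_sym n : symmetric (circ13 n).
Proof.
suff h x y : circ13 n x y -> circ13 n y x by move=> x y; apply/idP/idP; apply: h.
rewrite /circ13 -(opprB x y) !inE.
by case/or4P => /eqP ->; rewrite ?opprK eqxx ?orbT.
Qed.

Lemma Zn_nat_neq0 n k : (0 < k < n)%N -> k%:R != 0 :> 'Z_n.
Proof.
case/andP=> k0 kn; apply/eqP => /(congr1 val) /=.
have n1 : (1 < n)%N by apply: leq_ltn_trans kn.
by rewrite val_Zp_nat //= modn_small // => k00; rewrite k00 in k0.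
Qed.

Lemma circ13_irrefl n : (7 <= n)%N -> irreflexive (circ13 n).
Proof.
move=> n7 x; rewrite /circ13 subrr !inE !(eq_sym 0) !oppr_eq0.
rewrite (negbTE (@Zn_nat_neq0 n 1 _)) ?(leq_trans _ n7) //.
by rewrite (negbTE (@Zn_nat_neq0 n 3 _)) ?(leq_trans _ n7).
Qed.

Lemma circ13_identifiable n : (7 <= n)%N ->
  exists S, identifying_code (circ13 n) S.
Proof.
move=> n7; exists setT; apply/andP; split.
  apply/forallP => u; apply/set0Pn; exists u.
  by rewrite /code_trace setIT inE eqxx.
have nz k : (0 < k <= 6)%N -> k%:R <> 0 :> 'Z_n.
  case/andP=> k0 k6; apply/eqP/Zn_nat_neq0.
  by rewrite k0 (leq_trans _ n7).
apply/injectiveP => u v; rewrite /code_trace !setIT => /setP E.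
have not2 w t : w - t = 2 -> (t \in closed_nbh (circ13 n) w) = false.
  move=> D; apply/negP; rewrite inE /circ13 D !inE.
  case/orP => [/eqP tw|]; first by apply: (nz 2%N); rewrite // -D tw subrr.
  case/or4P => /eqP H.
  - by apply: (nz 1%N) => //; transitivity (2 - 1 : 'Z_n); [ring | rewrite H subrr].
  - by apply: (nz 3%N) => //; transitivity (2 - (-1) : 'Z_n); [ring | rewrite H subrr].
  - by apply: (nz 1%N) => //; transitivity (3 - 2 : 'Z_n); [ring | rewrite H subrr].
  - by apply: (nz 5%N) => //; transitivity (2 - (-3) : 'Z_n); [ring | rewrite H subrr].
have not2N w t : w - t = - 2 -> (t \in closed_nbh (circ13 n) w) = false.
  move=> D; apply/negP; rewrite inE /circ13 D !inE.
  case/orP => [/eqP tw|].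
    by apply: (nz 2%N) => //; rewrite -[LHS]opprK -D tw subrr oppr0.
  case/or4P => /eqP H.
  - by apply: (nz 3%N) => //; transitivity (1 - (-2) : 'Z_n); [ring | rewrite H subrr].
  - by apply: (nz 1%N) => //; transitivity ((-1) - (-2) : 'Z_n); [ring | rewrite H subrr].
  - by apply: (nz 5%N) => //; transitivity (3 - (-2) : 'Z_n); [ring | rewrite H subrr].
  - by apply: (nz 1%N) => //; transitivity ((-2) - (-3) : 'Z_n); [ring | rewrite H subrr].
have : v \in closed_nbh (circ13 n) u by rewrite E inE eqxx.
rewrite inE => /orP[/eqP ->//|]; rewrite /circ13 !inE.
have nb w t : w - t \in [:: 1; -1; 3; -3] -> t \in closed_nbh (circ13 n) w.
  by move=> h; rewrite inE /circ13 h orbT.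
case/or4P => /eqP D; exfalso.
- have := E (v + 3); rewrite [RHS]nb; last by rewrite !inE; apply/or4P/Or44/eqP; ring.
  by rewrite not2N // opprD addrA D; ring.
- have := E (v - 3); rewrite [RHS]nb; last by rewrite !inE; apply/or4P/Or43/eqP; ring.
  by rewrite not2 // opprD addrA D; ring.
- have := E (v + 1); rewrite [RHS]nb; last by rewrite !inE; apply/or4P/Or42/eqP; ring.
  by rewrite not2 // opprD addrA D; ring.
- have := E (v - 1); rewrite [RHS]nb; last by rewrite !inE; apply/or4P/Or41/eqP; ring.
  by rewrite not2N // opprD addrA D; ring.
Qed.

(* Main.v *)
(* Read an identifying code S as a cyclic binary word.  Whether the vertices
   x + 3, ..., x + 7 have nonempty, pairwise distinct traces depends only on
   the window S(x), ..., S(x + 10) of 11 consecutive letters.  In the de Bruijn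
   graph whose vertices are the words of length 10 and whose edges are the
   admissible windows, give the edge w the weight 4 - 11 w_0.  No closed walk
   has positive weight, because there is a potential psi on the vertices with
   psi(w_1 .. w_10) + 4 <= psi(w_0 .. w_9) + 11 w_0 for each admissible w.
   Summing this over the windows of S gives 4 n <= 11 #|S|. *)

Require Import Defs.
From mathcomp Require Import all_boot all_order all_algebra.
From mathcomp Require Import zify ring.

Set Implicit Arguments.
Unset Strict Implicit.
Unset Printing Implicit Defensive.

Import GRing.Theory Num.Theory.

(* With truncated subtraction, (p - q) + (q - p) is the distance of p and q. *)
Definition near (p q : nat) : bool := (p - q) + (q - p) \in [:: 0; 1; 3].

(** Positions 3 to 7 are those whose neighbours all lie in the window. Two traces differ iff the
    code meets the symmetric difference of the neighbourhoods. *)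
Definition admissible (w : seq bool) : bool :=
  all (fun p => has (fun r => near p r && nth false w r) (iota 0 11) &&
    all (fun q => (p == q) ||
           has (fun r => (near p r (+) near q r) && nth false w r) (iota 0 11))
      (iota 3 5)) (iota 3 5).

Fixpoint words (k : nat) : seq (seq bool) :=
  if k is k'.+1 then map (cons true) (words k') ++ map (cons false) (words k')
  else [:: [::]].

Lemma mem_words (w : seq bool) : w \in words (size w).
Proof.
elim: w => [|b w IHw] //=; rewrite mem_cat.
by case: b; rewrite map_f ?orbT.
Qed.

(** Lookup tables indexed by binary words, so that each value is computed once. *)
Inductive trie (A : Type) := Leaf of A | Node of trie A & trie A.

Fixpoint tabulate A (k : nat) (f : seq bool -> A) : trie A :=
  if k is k'.+1 then
    Node (tabulate k' (fun w => f (true :: w)))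
         (tabulate k' (fun w => f (false :: w)))
  else Leaf (f [::]).

Fixpoint lookup A (a : A) (t : trie A) (w : seq bool) : A :=
  match t, w with
  | Leaf x, _ => x
  | Node l r, b :: w' => lookup a (if b then l else r) w'
  | Node _ _, [::] => a
  end.

(* One Bellman-Ford step towards the supremum of the weights of the walks from
   [v]; truncated subtraction accounts for the empty walk. *)
Definition relax (adm : trie bool) (psi : trie nat) : trie nat :=
  tabulate 10 (fun v =>
    let after c :=
      if lookup false adm (rcons v c)
      then lookup 0 psi (rcons (behead v) c) + 4 - 11 * head false v else 0 in
    maxn (after true) (after false)).

(* Bellman-Ford is stationary after 27 steps. *)
Definition potential_trie : trie nat :=
  let adm := tabulate 11 admissible in iter 27 (relax adm) (Leaf 0).

Definition potential (v : seq bool) : nat := lookup 0 potential_trie v.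

(** The computed table is certified by testing all 2^11 words; the [let] makes the VM build it
    once. *)
Lemma potential_check :
  let psi := potential_trie in
  all (fun w => admissible w ==>
         (lookup 0 psi (behead w) + 4 <=
          lookup 0 psi (take 10 w) + 11 * head false w)) (words 11).
Proof. by vm_compute. Qed.

Lemma potential_le (w : seq bool) : size w = 11 -> admissible w ->
  potential (behead w) + 4 <= potential (take 10 w) + 11 * head false w.
Proof.
move=> sz_w; apply/implyP.
by apply: (allP potential_check); rewrite -sz_w mem_words.
Qed.

Local Open Scope ring_scope.

Section Windows.

Variables (n : nat) (S : {set 'Z_n}).

Definition window (k : nat) (x : 'Z_n) : seq bool :=
  mkseq (fun i => x + i%:R \in S) k.

Lemma window_cons k x : window k.+1 x = (x \in S) :: window k (x + 1).
Proof.
rewrite /window /mkseq /= addr0 (iotaDl 1 0) -map_comp; congr (_ :: _).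
by apply: eq_map => i /=; rewrite natrD addrA.
Qed.

Lemma take_window k x : take k (window k.+1 x) = window k x.
Proof.
by rewrite /window /mkseq -map_take take_iota; congr map; congr iota; lia.
Qed.

Lemma near_closed_nbh (x : 'Z_n) p q :
  near p q -> x + q%:R \in closed_nbh (circ13 n) (x + p%:R).
Proof.
move=> pq; rewrite inE /circ13.
have : [|| q == p, p == q + 1, q == p + 1, p == q + 3 | q == p + 3]%N.
  by move: pq; rewrite /near !inE; lia.
case/orP=> [/eqP ->|pq_dist]; first by rewrite eqxx.
apply/orP; right; rewrite !inE; apply/or4P.
by case/or4P: pq_dist => /eqP ->; rewrite natrD;
  [apply: Or41 | apply: Or42 | apply: Or43 | apply: Or44]; apply/eqP; ring.
Qed.

(** The bound [2 < p] keeps [p - 3] from being truncated. *)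
Lemma closed_nbh_near (x y : 'Z_n) p : (2 < p)%N ->
  y \in closed_nbh (circ13 n) (x + p%:R) ->
  exists r, [/\ (r <= p + 3)%N, near p r & y = x + r%:R].
Proof.
move=> p3; rewrite inE /circ13 => /orP[/eqP ->|].
  by exists p; rewrite /near subnn leq_addr.
have yE : y = x + p%:R - (x + p%:R - y) by ring.
rewrite !inE => /or4P[] /eqP d; rewrite d in yE.
- exists (p - 1)%N; split; [lia | rewrite /near !inE; lia |].
  by rewrite yE natrB; [ring | lia].
- exists (p + 1)%N; split; [lia | rewrite /near !inE; lia |].
  by rewrite yE natrD; ring.
- exists (p - 3)%N; split; [lia | rewrite /near !inE; lia |].
  by rewrite yE natrB //; ring.
- exists (p + 3)%N; split; [lia | rewrite /near !inE; lia |].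
  by rewrite yE natrD; ring.
Qed.

Lemma window_admissible x : (4 < n)%N -> identifying_code (circ13 n) S ->
  admissible (window 11 x).
Proof.
move=> n5 /identifying_codeP[ne sep].
have mem_w r : (r < 11)%N -> nth false (window 11 x) r = (x + r%:R \in S).
  by move=> r11; rewrite nth_mkseq.
(* A separating vertex has a representative [r <= p + 3 <= 10]. Even if the window wraps around the
   cycle, [near q r] would put that vertex in the trace at [q]. *)
have diff p q y : (3 <= p < 8)%N -> y \in code_trace (circ13 n) S (x + p%:R) ->
    y \notin code_trace (circ13 n) S (x + q%:R) ->
    has (fun r => (near p r && ~~ near q r) && nth false (window 11 x) r)
        (iota 0 11).
  move=> /andP[p3 p8]; rewrite inE.
  move=> /andP[/(closed_nbh_near p3)[r [rp pr ->]] rS].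
  rewrite inE rS andbT => nqr.
  apply/hasP; exists r; first by rewrite mem_iota; lia.
  rewrite mem_w ?rS ?andbT ?pr; last by lia.
  by apply: contra nqr; apply: near_closed_nbh.
apply/allP => p; rewrite mem_iota => p_range; apply/andP; split.
  have /set0Pn[y] := ne (x + p%:R).
  have p3 : (2 < p)%N by lia.
  rewrite inE => /andP[/(closed_nbh_near p3)[r [rp pr ->]] rS].
  by apply/hasP; exists r; rewrite ?mem_iota ?pr ?mem_w ?rS //; lia.
apply/allP => q; rewrite mem_iota => q_range.
apply/orP; have [|pq] := eqVneq p q; [by left | right].
(* The offsets differ by at most 4, which is less than [n]. *)
have neq_pq : x + p%:R != x + q%:R.
  wlog lt_pq : p q p_range q_range pq / (p < q)%N.
    move=> W; have [] := ltngtP p q; last by move=> E; rewrite E eqxx in pq.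
      exact: W.
    by move=> qp; rewrite eq_sym; apply: W => //; rewrite eq_sym.
  rewrite (inj_eq (addrI x)) eq_sym -subr_eq0 -natrB 1?ltnW //.
  by apply: Zn_nat_neq0; lia.
have [y] : exists y, (y \in code_trace (circ13 n) S (x + p%:R)) !=
                     (y \in code_trace (circ13 n) S (x + q%:R)).
  apply/existsP; rewrite -negb_forall; apply: contra (sep _ _ neq_pq).
  by move=> /forallP E; apply/eqP/setP => y; apply/eqP/E.
have [yp|yp] := boolP (_ \in code_trace _ _ (x + p%:R)).
  rewrite eq_sym eqb_id => /(diff p q _ p_range yp) h.
  by apply: (sub_has _ h) => r /=; case: (near p r); case: (near q r).
rewrite eq_sym eqbF_neg negbK => yq; have h := diff q p _ q_range yq yp.
by apply: (sub_has _ h) => r /=; case: (near p r); case: (near q r).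
Qed.

(* [psi] is a variable so that no conversion test unfolds [potential_trie]. *)
Lemma card_identifying_code (psi : seq bool -> nat) :
  (forall w, size w = 11%N -> admissible w ->
     (psi (behead w) + 4 <= psi (take 10 w) + 11 * head false w)%N) ->
  (4 < n)%N -> identifying_code (circ13 n) S -> (4 * n <= 11 * #|S|)%N.
Proof.
move=> psi_le n5 codeS.
have step (x : 'Z_n) : (psi (window 10 (x + 1)%R) + 4 <=
                        psi (window 10 x) + 11 * (x \in S))%N.
  have := psi_le (window 11 x) (size_mkseq _ _) (window_admissible x n5 codeS).
  by rewrite take_window (window_cons 10).
have cardZ : #|{: 'Z_n}| = n by rewrite card_ord Zp_cast // (leq_trans _ n5).
have : (\sum_(x : 'Z_n) (psi (window 10 (x + 1)%R) + 4) <=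
        \sum_(x : 'Z_n) (psi (window 10 x) + 11 * (x \in S)))%N.
  by apply: leq_sum => x _; apply: step.
rewrite [X in (X <= _)%N]big_split [X in (_ <= X)%N]big_split /=.
(* Translation by 1 permutes the vertices, so the potentials cancel. *)
rewrite [X in (_ <= X + _)%N](reindex_inj (addIr 1)) /= leq_add2l.
rewrite sum_nat_const cardZ mulnC -big_distrr /=.
by rewrite -sum1_card [in X in _ -> X]big_mkcond.
Qed.

End Windows.

Theorem theorem4 (n : nat) (hn : (13 <= n)%N) :
  (4 * n)%:R / 11%:R <= (gammaID (circ13 n))%:R :> rat.
Proof.
have n7 : (6 < n)%N by lia.
have [[S codeS <-] _] := gammaIDP (circ13_identifiable n7).
rewrite ler_pdivrMr // -natrM ler_nat [leqRHS]mulnC.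
by apply: card_identifying_code potential_le _ codeS; lia.
Qed.
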